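(* Let $E$ be an arbitrary nonempty subset of a Hilbert space $(X,|\cdot|)$, and let $(f,G):E\to\mathbb{R}\times X$ be a $1$-jet such that $M:=A(f,G)<\infty$. Let $$g(x)=\inf_{y\in E}\{f(y)+\langle G(y),x-y\rangle+M\varphi(|x-y|)\},\quad x\in X,$$ let $\mathcal{F}$ be the family of all functions $X\to\mathbb{R}$ of the form $$z\mapsto a+\langle\xi,z\rangle-\sum_{i=1}^n\lambda_iM\varphi(|z-p_i|),\qquad a\in\mathbb{R},\ \xi\in X^*,\ p_i\in X,\ \lambda_i\ge0,\ \sum_{i=1}^n\lambda_i=1,\ n\in\mathbb{N},$$ and define $$F(x)=\sup\{h(x)\ :\ h\in\mathcal{F},\ h\le g\},\quad x\in X.$$ Then $F$ is of class $C^{1,\omega}(X)$ and satisfies $(F,\nabla F)=(f,G)$ on $E$, with $A(F,\nabla F)\le2A(f,G)$.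
   Context: Spaces are real. $\omega:[0,\infty)\to[0,\infty)$ is a modulus of continuity: a concave, increasing, continuous function with $\omega(0)=0$ and $\lim_{t\to\infty}\omega(t)=\infty$. Put $\varphi(t)=\int_0^t\omega(s)\,ds$ for $t\ge0$. A $1$-jet on $E\subseteq X$ is a pair of functions $f:E\to\mathbb{R}$, $G:E\to X$ (the dual of $X$ is identified with $X$). $C^{1,\omega}(X)$ is the set of Fréchet differentiable $u:X\to\mathbb{R}$ for which there is a constant $C>0$ with $|\nabla u(x)-\nabla u(y)|\le C\,\omega(|x-y|)$ for all $x,y\in X$. For a $1$-jet $(f,G)$ on $E$, $$A(f,G)=\sup_{x\in X;\ y,z\in E,\ |x-y|+|x-z|>0}\frac{|f(y)+\langle G(y),x-y\rangle-f(z)-\langle G(z),x-z\rangle|}{\varphi(|x-y|)+\varphi(|x-z|)}\in[0,\infty].$$ For differentiable $F:X\to\mathbb{R}$, $A(F,\nabla F)$ is this quantity for the jet $(F,\nabla F)$ on $E=X$. *)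

(* Defs.v *)
From mathcomp Require Import all_boot all_order all_algebra.
From mathcomp Require Import all_classical all_reals all_analysis.
Import Order.TTheory GRing.Theory Num.Theory.
Import numFieldNormedType.Exports.

Set Implicit Arguments.
Unset Strict Implicit.
Unset Printing Implicit Defensive.

Local Open Scope classical_set_scope.
Local Open Scope ring_scope.

(* [omega] is a total function on [R]; only its values on [0, +oo[ matter.
   Monotonicity is required in the wide sense; together with concavity and
   divergence at +oo it implies strict monotonicity. *)
Record modulus_of_continuity (R : realType) (omega : R -> R) : Prop :=
  ModulusOfContinuity {
    modulus_ge0 : forall t : R, 0 <= t -> 0 <= omega t ;
    modulus_concave : convex_function (`[0, +oo[%classic : set R^o) (fun t => - omega t) ;
    modulus_increasing :
      {in `[0, +oo[ &, {homo omega : s t / s <= t}} ;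
    modulus_continuous : {within `[0, +oo[%classic, continuous omega} ;
    modulus0 : omega 0 = 0 ;
    modulus_pinfty : omega t @[t --> +oo] --> +oo }.

Definition modulus_primitive (R : realType) (omega : R -> R) (t : R) : R :=
  \int[lebesgue_measure]_(s in `[0, t]) omega s.

Section Hilbert.
Context (R : realType) (X : completeNormedModType R).
Variable dot : {dot X for idfun}.

(* With this, [X] is a real Hilbert space: its complete norm comes from [dot]. *)
Definition norm_from_dot : Prop := forall x : X, `|x| ^+ 2 = dot x x.

(* The Riesz representative of the differential; where [u] is differentiable and
   [norm_from_dot] holds, it exists and is unique by the Riesz theorem. *)
Definition grad (u : X -> R) (x : X) : X :=
  get [set v : X | forall h : X, 'd u x h = dot v h].

Definition C1omega (omega : R -> R) (u : X -> R) : Prop :=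
  (forall x : X, differentiable u x) /\
  exists2 C : R, 0 < C &
    forall x y : X, `|grad u x - grad u y| <= C * omega `|x - y|.

(* A jet on [E] is given by total functions [f] and [G] whose values outside
   [E] play no role. The quotients are nonnegative, so taking the maximum with
   0 only matters when there are none, i.e. if [X] is the null space: the
   supremum is taken in [0, +oo], whereas [ereal_sup set0] is -oo. *)
Definition jetA (omega : R -> R) (E : set X) (f : X -> R) (G : X -> X) : \bar R :=
  let phi := modulus_primitive omega in
  maxe 0%E (ereal_sup [set q : \bar R | exists x y z : X,
    [/\ E y, E z, 0 < `|x - y| + `|x - z| &
      q = (`|f y + dot (G y) (x - y) - f z - dot (G z) (x - z)|
           / (phi `|x - y| + phi `|x - z|))%:E]]).

Definition upper_env (omega : R -> R) (M : R) (E : set X)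
    (f : X -> R) (G : X -> X) (x : X) : \bar R :=
  ereal_inf [set (f y + dot (G y) (x - y)
                  + M * modulus_primitive omega `|x - y|)%:E | y in E].

(* The dual of [X] is identified with [X] through [dot]. *)
Definition familyF (omega : R -> R) (M : R) : set (X -> R) :=
  [set h | exists (n : nat) (a : R) (xi : X) (p : 'I_n -> X) (lambda : 'I_n -> R),
    [/\ forall i, 0 <= lambda i,
        \sum_(i < n) lambda i = 1 &
        h = fun z => a + dot xi z
              - \sum_(i < n) lambda i * M * modulus_primitive omega `|z - p i|]].

Definition lower_env (omega : R -> R) (M : R) (g : X -> \bar R) (x : X) : \bar R :=
  ereal_sup [set (h x)%:E | h in
    [set h | familyF omega M h /\ forall z : X, ((h z)%:E <= g z)%E]].

End Hilbert.

(* Main.v *)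
Require Import Defs.
From HB Require Import structures.
From mathcomp Require Import all_boot all_order all_algebra.
From mathcomp Require Import all_classical all_reals all_analysis.
From mathcomp Require Import ring lra.
Import Order.TTheory GRing.Theory Num.Theory.
Import numFieldNormedType.Exports.

Local Open Scope classical_set_scope.
Local Open Scope ring_scope.

(** Write phi for the primitive of omega, U_y(z) = f(y) + <G(y), z - y> +
    M phi(|z - y|) for y in E, and K = 2M. The function F is the supremum of
    the set S of all members h of the family that lie below every U_y.

    The one analytic fact is that phi(|.|) bends upwards by at most 2 phi: at
    every point x there is a vector v with
      phi(|x + k|) <= phi(|x|) + <v, k> + 2 phi(|k|)   for all k
    (phi_norm_tangent). It comes from the concavity of s |-> phi(sqrt s), which
    makes the inner product structure enter through |x + k|^2
    (phi_le_tangent_parabola). Consequently each h in S is bounded below at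
    each point by an affine function minus K phi (familyF_tangent), and each
    U_y is bounded above by an affine function plus K phi (cone_tangent).

    The first property passes to the supremum F. The second one passes to F
    through averaging: the family is stable under translations and convex
    combinations (familyF_avg), so if a k1 + b k2 = 0, a + b = 1 and h1, h2
    lie in S, then a h1(. + k1) + b h2(. + k2) - K (a phi(|k1|) + b phi(|k2|))
    is again in S, because in the corresponding average of U_y the affine
    parts cancel. Taking suprema,
      a F(x + k1) + b F(x + k2) <= F(x) + K (a phi(|k1|) + b phi(|k2|)).

    These two facts alone yield the Taylor estimate
      |F(y + k) - F(y) - <v, k>| <= K phi(|k|)
    (envelope_taylor): the gradients at y of elements of S that almost attain
    F(y) form a Cauchy sequence, since symmetric averaging pins the increment
    F(y + k) - F(y) within O(phi(|k|)) of each of them; the limit v gives the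
    lower estimate. Averaging k against -m k with m tending to 0 gives the
    upper one with the same constant, because phi(t) = o(t).

    The triangle inequality turns the Taylor estimate into A(F, grad F) <= 2M
    (jetA_le), and testing it at two symmetric points gives the modulus of
    continuity of the gradient (grad_modulus). Finally, for y in E, the
    definition of M puts the cone U_y - 2M phi(|. - y|) in S (jetA_whitney), so
    F is squeezed between two functions tangent to (f(y), G(y)) at y. *)

(** * The modulus of continuity and its primitive *)

Section Modulus.
Context {R : realType} {omega : R -> R}.
Hypothesis homega : modulus_of_continuity omega.

Local Notation mu := (@lebesgue_measure R).
Local Notation phi := (modulus_primitive omega).

Lemma modulus_le (s t : R) : 0 <= s -> s <= t -> omega s <= omega t.
Proof.
move=> s0 st; apply: (modulus_increasing homega) => //; rewrite in_itv/= andbT//.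
exact: le_trans st.
Qed.

(** Concavity and omega(0) = 0 make omega(s) / s nonincreasing. *)
Lemma modulus_slope_le (s t : R) : 0 < s -> s <= t ->
  s * omega t <= t * omega s.
Proof.
move=> s0 st; have t0 : 0 < t := lt_le_trans s0 st.
have st0 : 0 <= s / t by rewrite divr_ge0// ltW.
have st1 : s / t <= 1 by rewrite ler_pdivrMr// mul1r.
have := modulus_concave homega (Itv01 st0 st1).
have t_in : (t : R^o) \in (`[0, +oo[%classic : set R^o).
  by rewrite inE/= in_itv/= andbT ltW.
have o_in : (0 : R^o) \in (`[0, +oo[%classic : set R^o).
  by rewrite inE/= in_itv/= andbT.
move=> /(_ _ _ t_in o_in).
set u := conv _ _ _; have -> : u = s.
  have -> : u = s / t * t + (1 - s / t) * 0 by [].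
  by rewrite mulr0 addr0 divfK ?gt_eqF.
rewrite convRE /= (modulus0 homega) oppr0 mulr0 addr0.
by rewrite mulrN lerN2 mulrAC ler_pdivrMr// (mulrC (omega s)).
Qed.

Lemma modulus_within_continuous (a b : R) : 0 <= a -> {within `[a, b], continuous omega}.
Proof.
move=> a0; apply: continuous_subspaceW (modulus_continuous homega).
by move=> x /=; rewrite !in_itv/= andbT => /andP[/(le_trans a0)].
Qed.

Lemma integrable_modulus (a b : R) : 0 <= a -> mu.-integrable `[a, b] (EFin \o omega).
Proof.
move=> a0; apply: continuous_compact_integrable; first exact: segment_compact.
exact: modulus_within_continuous.
Qed.

Lemma phiB (a b : R) : 0 <= a -> a <= b ->
  phi b - phi a = \int[mu]_(s in `[a, b]) omega s.
Proof.
move=> a0 ab; rewrite /modulus_primitive Rintegral_itvB.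
- rewrite Rintegral_itv_obnd_cbnd//.
  apply: (@integrableS _ _ _ mu `[a, b]); [| | |exact: integrable_modulus] => //.
  by apply: subset_itvr; rewrite bnd_simp.
- exact: integrable_modulus.
- by rewrite bnd_simp.
- by rewrite bnd_simp.
Qed.

Lemma Rintegral_linear (c a b : R) : a <= b ->
  \int[mu]_(s in `[a, b]) (c * s) = c / 2 * (b ^+ 2 - a ^+ 2).
Proof.
rewrite le_eqVlt => /predU1P[->|ab].
  by rewrite set_itv1 Rintegral_set1 subrr mulr0.
rewrite /Rintegral (@continuous_FTC2 _ _ (fun x => c / 2 * x ^+ 2))//=.
- by rewrite mulrBr.
- apply: continuous_subspaceT => x.
  by apply: cvgM; [exact: cvg_cst|exact: cvg_id].
- split => [x _| |].
  + exact: ex_derive.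
  + apply: cvg_at_right_filter; apply: cvgM; first exact: cvg_cst.
    exact: exprn_continuous.
  + apply: cvg_at_left_filter; apply: cvgM; first exact: cvg_cst.
    exact: exprn_continuous.
- move=> x _; rewrite derive1E derive_val /= !scaler1.
  by rewrite -[LHS]/(c / 2 * (x + x)); field.
Qed.

Lemma phi_0 : phi 0 = 0.
Proof. by rewrite /modulus_primitive set_itv1 Rintegral_set1. Qed.

Lemma Rintegral_itv_cst (c a b : R) : a <= b -> \int[mu]_(s in `[a, b]) c = (b - a) * c.
Proof.
move=> ab; rewrite Rintegral_cst//= lebesgue_measure_itv/= lte_fin mulrC.
by case: ltgtP ab => //= -> _; rewrite subrr.
Qed.

Lemma integrable_linear_itv (c a b : R) :
  mu.-integrable `[a, b] (EFin \o (fun s => c * s)).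
Proof.
apply: continuous_compact_integrable; first exact: segment_compact.
apply: continuous_subspaceT => x.
by apply: cvgM; [exact: cvg_cst|exact: cvg_id].
Qed.

Lemma integrable_cst_itv (c a b : R) :
  mu.-integrable `[a, b] (EFin \o (fun _ => c)).
Proof.
apply: continuous_compact_integrable; first exact: segment_compact.
by apply: continuous_subspaceT => x; exact: cvg_cst.
Qed.

Lemma phi_ge_mul (a b : R) : 0 <= a -> a <= b ->
  (b - a) * omega a <= phi b - phi a.
Proof.
move=> a0 ab; rewrite phiB// -Rintegral_itv_cst//; apply: le_Rintegral => //.
- exact: integrable_cst_itv.
- exact: integrable_modulus.
- by move=> x /=; rewrite in_itv/= => /andP[ax _]; exact: modulus_le.
Qed.

Lemma phi_le_mul (a b : R) : 0 <= a -> a <= b ->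
  phi b - phi a <= (b - a) * omega b.
Proof.
move=> a0 ab; rewrite phiB// -Rintegral_itv_cst//; apply: le_Rintegral => //.
- exact: integrable_modulus.
- exact: integrable_cst_itv.
- move=> x /=; rewrite in_itv/= => /andP[ax xb].
  by apply: modulus_le => //; exact: le_trans ax.
Qed.

Lemma phi_le (a b : R) : 0 <= a -> a <= b -> phi a <= phi b.
Proof.
move=> a0 ab; rewrite -subr_ge0; apply: le_trans (phi_ge_mul a b a0 ab).
by rewrite mulr_ge0 ?subr_ge0// modulus_ge0.
Qed.

Lemma phi_ge0 (t : R) : 0 <= t -> 0 <= phi t.
Proof. by move=> t0; rewrite -phi_0; exact: phi_le. Qed.

(** The concave function s |-> phi (sqrt s) lies below its tangent at q^2,
    written with s = rho^2. The slope is omega q / (2 q), and the inequality is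
    obtained by integrating: omega(s) is at least (omega q / q) s for s <= q
    and at most that for s >= q. *)
Lemma phi_le_tangent_parabola (q rho : R) : 0 < q -> 0 <= rho ->
  phi rho <= phi q + omega q / q / 2 * (rho ^+ 2 - q ^+ 2).
Proof.
move=> q0 rho0; have [qr|/ltW rq] := leP q rho.
- rewrite -lerBlDl phiB ?(ltW q0)// -Rintegral_linear//; apply: le_Rintegral => //.
  + by apply: integrable_modulus; exact: ltW.
  + exact: integrable_linear_itv.
  + move=> s /=; rewrite in_itv/= => /andP[qs _].
    by rewrite mulrAC ler_pdivlMr// mulrC (mulrC (omega q)) modulus_slope_le.
- rewrite addrC -lerBlDr -opprB -(opprB _ (rho ^+ 2)) mulrN lerN2.
  rewrite phiB// -Rintegral_linear//; apply: le_Rintegral => //.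
  + exact: integrable_linear_itv.
  + exact: integrable_modulus.
  + move=> s /=; rewrite in_itv/= => /andP[/(le_trans rho0) s0 sq].
    rewrite mulrAC ler_pdivrMr// mulrC (mulrC _ q).
    move: s0; rewrite le_eqVlt => /predU1P[<-|s0]; last exact: modulus_slope_le.
    by rewrite (modulus0 homega) mulr0 mul0r.
Qed.

(** A zero of omega at t > 0 would force omega <= 0 beyond t by the monotone
    slopes, against divergence. *)
Lemma modulus_gt0 (t : R) : 0 < t -> 0 < omega t.
Proof.
move=> t0; rewrite lt_neqAle modulus_ge0 ?ltW// andbT eq_sym.
apply/negP => /eqP wt0.
have /cvgryPgt/(_ 0) := modulus_pinfty homega.
move=> /(@filterI _ _ _ _ _ (nbhs_pinfty_ge (num_real t))) /filter_ex[s/= [ts ws]].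
have := modulus_slope_le _ _ t0 ts; rewrite wt0 mulr0 leNgt => /negP; apply.
by rewrite mulr_gt0.
Qed.

Lemma phi_gt0 (t : R) : 0 < t -> 0 < phi t.
Proof.
move=> t0; have := phi_ge_mul (t / 2) t.
have := phi_ge0 (t / 2); have := modulus_gt0 (t / 2).
move=> /(_ ltac:(lra)) h1 /(_ ltac:(lra)) h2 /(_ ltac:(lra) ltac:(lra)) h3.
nra.
Qed.

Lemma phi_le_modulus (t : R) : 0 <= t -> phi t <= t * omega t.
Proof. by move=> t0; have := phi_le_mul 0 t; rewrite phi_0 !subr0; apply. Qed.

Lemma modulus_small (e : R) : 0 < e -> exists2 d, 0 < d & omega d <= e.
Proof.
move=> e0.
have : omega x @[x --> within `[0, +oo[%classic (nbhs (0 : R))] --> omega 0.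
  move/subspace_continuousP : (modulus_continuous homega); apply => /=.
  by rewrite in_itv/= lexx.
rewrite (modulus0 homega) => /cvgrPdist_le /(_ e e0).
rewrite /prop_near1/= /within/= => /nbhs_ballP[d /= d0 H].
exists (d / 2); first by rewrite divr_gt0.
have /= := H (d / 2); rewrite sub0r normrN.
have d20 : 0 <= d / 2 by rewrite divr_ge0// ltW.
rewrite /ball/= sub0r normrN ger0_norm// in_itv/= d20 => /(_ _ isT).
by rewrite (ger0_norm (modulus_ge0 homega d20)); apply; lra.
Qed.
End Modulus.

(** * Real inner product spaces *)

Section InnerProduct.
Context {R : realType} {X : completeNormedModType R} {dot : {dot X for idfun}}.
Hypothesis hdot : norm_from_dot dot.

Lemma dotC (x y : X) : dot x y = dot y x.
Proof. by rewrite hermC expr0 mul1r. Qed.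

Lemma dotDr (x y z : X) : dot x (y + z) = dot x y + dot x z.
Proof. exact: linearDr. Qed.

Lemma dotZr (a : R) (x y : X) : dot x (a *: y) = a * dot x y.
Proof. by rewrite linearZr_LR. Qed.

Lemma dotDl (x y z : X) : dot (x + y) z = dot x z + dot y z.
Proof. by rewrite dotC dotDr !(dotC z). Qed.

Lemma dotZl (a : R) (x y : X) : dot (a *: x) y = a * dot x y.
Proof. by rewrite dotC dotZr dotC. Qed.

Lemma dotNr (x y : X) : dot x (- y) = - dot x y.
Proof. by rewrite -scaleN1r dotZr mulN1r. Qed.

Lemma dotNl (x y : X) : dot (- x) y = - dot x y.
Proof. by rewrite dotC dotNr dotC. Qed.

Lemma dot0r (x : X) : dot x 0 = 0.
Proof. by rewrite -(scale0r 0) dotZr mul0r. Qed.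

Lemma dot0l (x : X) : dot 0 x = 0.
Proof. by rewrite dotC dot0r. Qed.

Lemma dot_suml (n : nat) (v : 'I_n -> X) (k : X) :
  dot (\sum_i v i) k = \sum_i dot (v i) k.
Proof.
by apply: (big_morph (fun x => dot x k)) => [x y|]; rewrite ?dotDl ?dot0l.
Qed.

Lemma sqr_normD (x y : X) :
  `|x + y| ^+ 2 = `|x| ^+ 2 + 2 * dot x y + `|y| ^+ 2.
Proof. by rewrite !hdot dotDl !dotDr (dotC y x); ring. Qed.

Lemma dot_le_norm (x y : X) : dot x y <= `|x| * `|y|.
Proof.
have h : `|x + y| ^+ 2 <= (`|x| + `|y|) ^+ 2.
  by rewrite lerXn2r ?nnegrE ?addr_ge0// ler_normD.
rewrite sqr_normD in h; nra.
Qed.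

Lemma norm_dot_le (x y : X) : `|dot x y| <= `|x| * `|y|.
Proof. by rewrite ler_norml dot_le_norm lerNl -dotNr -(normrN y) dot_le_norm. Qed.

(** The dual characterization of the norm, on a sphere of radius d: a bound
    with remainders in phi(|k|) is not homogeneous in k, so the scale matters. *)
Lemma norm_le_of_dot (x : X) (d c : R) : 0 < d ->
  (forall k, `|k| = d -> dot x k <= c) -> 0 <= c -> d * `|x| <= c.
Proof.
move=> d0 H c0; have [->|x0] := eqVneq x 0; first by rewrite normr0 mulr0.
have nx0 : 0 < `|x| by rewrite normr_gt0.
have := H ((d / `|x|) *: x).
rewrite normrZ normf_div normr_id (gtr0_norm d0) divfK ?gt_eqF// => /(_ erefl).
by rewrite dotZr -hdot expr2 mulrA divfK ?gt_eqF.
Qed.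

Context {omega : R -> R}.
Hypothesis homega : modulus_of_continuity omega.
Local Notation phi := (modulus_primitive omega).

(** The vector v is the gradient omega(r) x / r of phi(|.|) at x, with r = |x|
    and t = |k|. If t <= 2 r, the tangent parabola at r leaves the remainder
    (omega(r) / 2 r) t^2, and slopes compared at t / 2 <= r bound it by
    t omega(t / 2) <= 2 phi(t). If t > 2 r, the extreme position of k is
    opposite to x, where |x + k| = t - r; so the tangent parabola is taken at
    t - r, and the monotonicity of omega does the rest. *)
Lemma phi_norm_tangent (x : X) : exists v : X, forall k : X,
  phi `|x + k| <= phi `|x| + dot v k + 2 * phi `|k|.
Proof.
have [->|x0] := eqVneq x 0.
  exists 0 => k; rewrite add0r dot0l normr0 phi_0.
  by have := phi_ge0 homega _ (normr_ge0 k); lra.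
have r0 : 0 < `|x| by rewrite normr_gt0.
exists ((omega `|x| / `|x|) *: x) => k; rewrite dotZl.
have := sqr_normD x k; have := dot_le_norm (- x) k.
rewrite dotNl normrN; have := normr_ge0 k; have := normr_ge0 (x + k).
move: `|x| `|k| `|x + k| (dot x k) r0 => r t rho m r0 rho0 t0 CS E.
have wr0 : 0 <= omega r by rewrite modulus_ge0// ltW.
set c := omega r / r; have cr : c * r = omega r by rewrite divfK ?gt_eqF.
have c0 : 0 <= c by rewrite divr_ge0// ltW.
have [tr|rt] := leP t (2 * r).
- have := phi_le_tangent_parabola homega _ _ r0 rho0; rewrite -/c E => h.
  suff : c / 2 * t ^+ 2 <= 2 * phi t by lra.
  move: t0; rewrite le_eqVlt => /predU1P[<-|t0].
    by rewrite phi_0 expr0n /= !mulr0.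
  have s0 : 0 < t / 2 by lra.
  have cs : c * (t / 2) <= omega (t / 2).
    rewrite /c mulrAC ler_pdivrMr// (mulrC (omega r)) (mulrC (omega (t / 2))).
    by apply: modulus_slope_le => //; lra.
  have := phi_ge_mul homega (t / 2) t (ltW s0) ltac:(lra).
  have := phi_ge0 homega _ (ltW s0).
  have -> : c / 2 * t ^+ 2 = 2 * ((t / 2) * (c * (t / 2))) by field.
  have : t / 2 * (c * (t / 2)) <= t / 2 * omega (t / 2) by rewrite ler_pM2l.
  lra.
- have q0 : 0 < t - r by lra.
  have := phi_le_tangent_parabola homega _ _ q0 rho0; rewrite E => h.
  have qc : omega (t - r) / (t - r) <= c.
    rewrite ler_pdivrMr// /c mulrAC ler_pdivlMr// mulrC (mulrC (omega r)).
    by apply: modulus_slope_le => //; lra.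
  have h2 : omega (t - r) / (t - r) * (m + r * t) <= c * (m + r * t).
    by apply: ler_wpM2r => //; lra.
  have h3 := phi_ge_mul homega (t - r) t (ltW q0) ltac:(lra).
  have h4 := phi_ge_mul homega r t (ltW r0) ltac:(lra).
  have h5 := phi_ge0 homega _ (ltW r0).
  have h6 : r * omega r <= r * omega (t - r).
    by rewrite ler_pM2l// modulus_le//; lra.
  have h7 : omega (t - r) / (t - r) / 2 *
     (r ^+ 2 + 2 * m + t ^+ 2 - (t - r) ^+ 2) =
     omega (t - r) / (t - r) * (m + r * t).
    by field; rewrite gt_eqF.
  rewrite h7 in h.
  have h8 : c * (m + r * t) = c * m + t * omega r by rewrite -cr; ring.
  rewrite h8 in h2.
  have h9 : (t - (t - r)) * omega (t - r) = r * omega (t - r) by ring.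
  rewrite h9 in h3; lra.
Qed.

(** * First-order Taylor estimates with remainder phi *)

(** A remainder K phi(|k|) is o(|k|), so the estimate identifies the
    differential; definiteness of the inner product then makes v the only
    candidate for the choice made by grad. *)
Lemma taylor_gradient (F : X -> R) (y v : X) (K : R) : 0 <= K ->
  (forall k, `|F (y + k) - F y - dot v k| <= K * phi `|k|) ->
  differentiable F y /\ grad dot F y = v.
Proof.
move=> K0 H.
have dlin : linear (dot v : X -> R).
  by move=> a u w; rewrite dotDr dotZr.
pose dM := GRing.isLinear.Build _ _ _ _ _ dlin.
pose dL : {linear X -> R} := HB.pack (dot v : X -> R) dM.
have dLc : continuous dL.
  move=> x; apply/cvgrPdist_le => /= e e0.
  near=> z; rewrite -linearB /=.
  apply: le_trans (norm_dot_le _ _) _.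
  have : `|x - z| <= e / (`|v| + 1).
    near: z; apply: cvgr_dist_le; [exact: cvg_id|].
    by rewrite divr_gt0// ltr_wpDl.
  rewrite ler_pdivlMr ?ltr_wpDl// => h.
  by have := normr_ge0 (x - z); lra.
have dL0 : F \o shift y = cst (F y) + dL +o_ 0 id.
  apply/eqaddoP => e e0.
  have [d d0 wd] := modulus_small homega (e / (K + 1))
    ltac:(by rewrite divr_gt0// ltr_wpDl).
  near=> k.
  have kd : `|k| <= d.
    by near: k; exact: nbhs0_le.
  rewrite /=/cst/=.
  have -> : (F \o shift y - (cst (F y) + dL)) k = F (y + k) - F y - dot v k.
    rewrite /= /cst/=.
    by rewrite -[LHS]/(F (k + y) - (F y + dot v k)) (addrC k) opprD addrA.
  apply: le_trans (H k) _.
  have := phi_le_modulus homega _ (normr_ge0 k).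
  have := modulus_le homega _ _ (normr_ge0 k) kd.
  have := modulus_ge0 homega (ltW d0); have := normr_ge0 k.
  move: wd; rewrite ler_pdivlMr ?ltr_wpDl//.
  move: `|k| (omega d) => a w we a0 w0 ww pw.
  apply: (@le_trans _ _ (K * (a * w))).
    by rewrite ler_wpM2l// (le_trans pw)// ler_wpM2l.
  by rewrite mulrCA mulrC ler_wpM2r//; lra.
have dE : 'd F y = dL :> (X -> R) by apply: diff_unique.
split.
  by apply/diff_locallyP; rewrite dE.
rewrite /grad; set S := [set _ | _].
have Sv : S v by move=> h; rewrite dE.
have Sg : S (get S) := getI Sv.
apply/eqP; rewrite -subr_eq0 -normr_eq0 -sqrf_eq0 hdot dotDl dotNl.
by rewrite -Sg Sv subrr.
Unshelve. all: by end_near.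
Qed.

(** The Taylor polynomials of F at x and y differ by an affine function which,
    near x and y, is bounded by the two remainders. Its values at x + u and
    x - u with |u| = |x - y| determine its slope along u. The constant 5 is
    the sum of phi(2d) <= 4 d omega(d) and phi(d) <= d omega(d). *)
Lemma grad_modulus (F : X -> R) (gF : X -> X) (K : R) : 0 <= K ->
  (forall y k, `|F (y + k) - F y - dot (gF y) k| <= K * phi `|k|) ->
  forall x y, `|gF x - gF y| <= 5 * K * omega `|x - y|.
Proof.
move=> K0 H x y; have [->|xy] := eqVneq x y.
  by rewrite !subrr !normr0 (modulus0 homega) mulr0.
have d0 : 0 < `|x - y| by rewrite normr_gt0 subr_eq0.
set d := `|x - y| in d0 *.
have d20 : 0 < 2 * d by rewrite mulr_gt0.
have w2 : omega (2 * d) <= 2 * omega d.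
  have := modulus_slope_le homega d (2 * d) d0 ltac:(lra).
  by rewrite -mulrA mulrCA ler_pM2l.
have wd0 := modulus_ge0 homega (ltW d0).
have p2 : phi (2 * d) <= 4 * (d * omega d).
  have := phi_le_modulus homega _ (ltW d20).
  have : d * omega (2 * d) <= d * (2 * omega d) by rewrite ler_pM2l.
  lra.
have p1 := phi_le_modulus homega _ (ltW d0).
rewrite -(ler_pM2l d0).
apply: norm_le_of_dot => // [u ud|]; last first.
  by rewrite !mulr_ge0// ltW.
have E s : y + (x - y + s) = x + s by rewrite addrA subrKC.
have p3 s : `|s| = d -> phi `|x - y + s| <= 4 * (d * omega d).
  move=> sd; apply: le_trans p2; apply: (phi_le homega) => //.
  by apply: le_trans (ler_normD _ _) _; rewrite sd -/d; lra.
have := H x u; have := H x (- u).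
have := H y (x - y + u); have := H y (x - y - u).
rewrite !E !normrN !ud.
have := p3 u ud; have := p3 (- u); rewrite normrN => /(_ ud).
move=> /(ler_wpM2l K0) q1 /(ler_wpM2l K0) q2; have q3 := ler_wpM2l K0 p1.
rewrite !ler_norml !dotDr !dotNr !dotDl !dotNl.
move=> /andP[? ?] /andP[? ?] /andP[? ?] /andP[? ?].
lra.
Qed.

(** When x = y = z the quotient is absent from the supremum, but both sides
    vanish; otherwise positivity of phi allows clearing the denominator. *)
Lemma jetA_whitney (E : set X) (f : X -> R) (G : X -> X) (x y z : X) :
  (jetA dot omega E f G < +oo)%E -> E y -> E z ->
  `|f y + dot (G y) (x - y) - f z - dot (G z) (x - z)| <=
    fine (jetA dot omega E f G) * (phi `|x - y| + phi `|x - z|).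
Proof.
move=> Afin Ey Ez.
have A0 : (0 <= jetA dot omega E f G)%E by rewrite le_max lexx.
have Anum : jetA dot omega E f G \is a fin_num by rewrite ge0_fin_numE.
have := addr_ge0 (normr_ge0 (x - y)) (normr_ge0 (x - z)).
rewrite le_eqVlt => /predU1P[s0|s0].
  have : `|x - y| == 0.
    by rewrite eq_le normr_ge0 andbT; have := normr_ge0 (x - z); lra.
  have : `|x - z| == 0.
    by rewrite eq_le normr_ge0 andbT; have := normr_ge0 (x - y); lra.
  rewrite !normr_eq0 !subr_eq0 => /eqP <- /eqP <-.
  by rewrite subrr !normr0 phi_0 !addr0 mulr0 !dot0r addr0 subrr subr0 normr0.
have p0 : 0 < phi `|x - y| + phi `|x - z|.
  have := phi_ge0 homega _ (normr_ge0 (x - y)).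
  have := phi_ge0 homega _ (normr_ge0 (x - z)) => pz py.
  have [xy|xy] := eqVneq `|x - y| 0.
    by rewrite ltr_wpDl// (phi_gt0 homega)//; rewrite xy add0r in s0.
  by rewrite ltr_pwDl// (phi_gt0 homega)// lt_neqAle eq_sym xy normr_ge0.
rewrite -ler_pdivrMr// -lee_fin fineK// /jetA le_max; apply/orP; right.
by apply: ereal_sup_ubound; exists x, y, z; split.
Qed.

(** Both Taylor polynomials are compared with F(x) itself. *)
Lemma jetA_le (F : X -> R) (gF : X -> X) (K : R) : 0 <= K ->
  (forall y k, `|F (y + k) - F y - dot (gF y) k| <= K * phi `|k|) ->
  (jetA dot omega setT F gF <= K%:E)%E.
Proof.
move=> K0 H; rewrite ge_max lee_fin K0 /=.
apply: ge_ereal_sup => _ [x [y [z [_ _ s0 ->]]]]; rewrite lee_fin.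
have py := phi_ge0 homega _ (normr_ge0 (x - y)).
have pz := phi_ge0 homega _ (normr_ge0 (x - z)).
have := addr_ge0 py pz; rewrite le_eqVlt => /predU1P[<-|p0].
  by rewrite invr0 mulr0.
rewrite ler_pdivrMr//.
have := H y (x - y); have := H z (x - z); rewrite !subrKC !ler_norml.
by move=> /andP[? ?] /andP[? ?]; apply/andP; split; lra.
Qed.

(** * Envelopes of functions stable under averaging *)

Section Envelope.
Context {K : R} {S : set (X -> R)} {F : X -> R}.
Hypothesis K0 : 0 <= K.
Hypothesis S_tangent : forall h, S h -> forall y, exists w : X, forall k,
  h y + dot w k - K * phi `|k| <= h (y + k).
Hypothesis S_avg : forall h1 h2 a b k1 k2, S h1 -> S h2 ->
  0 <= a -> 0 <= b -> a + b = 1 -> a *: k1 + b *: k2 = 0 ->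
  exists2 h, S h & forall x,
    a * h1 (x + k1) + b * h2 (x + k2) - K * (a * phi `|k1| + b * phi `|k2|) <= h x.
Hypothesis F_ub : forall h x, S h -> h x <= F x.
Hypothesis F_lub : forall x e, 0 < e -> exists2 h, S h & F x - e < h x.

(** Averaging almost maximal elements at x + k1 and x + k2 produces a
    competitor at x. *)
Lemma envelope_avg (a b : R) (k1 k2 x : X) :
  0 <= a -> 0 <= b -> a + b = 1 -> a *: k1 + b *: k2 = 0 ->
  a * F (x + k1) + b * F (x + k2) <= F x + K * (a * phi `|k1| + b * phi `|k2|).
Proof.
move=> a0 b0 ab k12; apply/ler_addgt0Pr => e e0.
have [h1 S1 H1] := F_lub (x + k1) e e0.
have [h2 S2 H2] := F_lub (x + k2) e e0.
have [h Sh H] := S_avg _ _ _ _ _ _ S1 S2 a0 b0 ab k12.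
have := H x; have := F_ub h x Sh.
have : a * (F (x + k1) - e) <= a * h1 (x + k1) by rewrite ler_wpM2l// ltW.
have : b * (F (x + k2) - e) <= b * h2 (x + k2) by rewrite ler_wpM2l// ltW.
have : a * e + b * e = e by rewrite -mulrDl ab mul1r.
lra.
Qed.

(** Let h_n in S satisfy h_n(y) > F(y) - eps_n and have lower tangent w_n at y.
    Then F(y + k) - F(y) - <w_n, k> is at least - K phi(|k|) - eps_n, and at
    most 3 K phi(|k|) + eps_n by averaging k and -k. Comparing two indices on
    a sphere |k| = d bounds |w_n - w_m| by 4 K omega(d) + (eps_n + eps_m) / d,
    which is small if d is chosen first. *)
Lemma envelope_tangent (y : X) : exists v : X, forall k,
  F y + dot v k - K * phi `|k| <= F (y + k).
Proof.
pose eps n : R := n.+1%:R^-1.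
have eps0 n : 0 < eps n by rewrite invr_gt0.
have /choice[w Hw] : forall n, exists w : X, forall k,
    F y + dot w k - K * phi `|k| - eps n <= F (y + k).
  move=> n; have [h Sh hF] := F_lub y _ (eps0 n).
  have [w Hw] := S_tangent h Sh y; exists w => k.
  by have := F_ub h (y + k) Sh; have := Hw k; lra.
have Hw' n k : F (y + k) <= F y + dot (w n) k + 3 * K * phi `|k| + eps n.
  have := envelope_avg (1 / 2) (1 / 2) k (- k) y.
  rewrite scalerN subrr normrN => /(_ ltac:(lra) ltac:(lra) ltac:(lra) erefl).
  by have := Hw n (- k); rewrite dotNr normrN; lra.
have dist n m d : 0 < d ->
    d * `|w n - w m| <= 4 * K * (d * omega d) + eps n + eps m.
  move=> d0; have wd0 : 0 <= omega d by rewrite modulus_ge0// ltW.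
  have := eps0 n; have := eps0 m => em en.
  apply: norm_le_of_dot => // [k kd|]; last first.
    have : 0 <= K * (d * omega d) by rewrite !mulr_ge0// ltW.
    lra.
  have := Hw n k; have := Hw' m k; rewrite kd dotDl dotNl.
  have : K * phi d <= K * (d * omega d).
    by rewrite ler_wpM2l// (phi_le_modulus homega)// ltW.
  lra.
have small d : 0 < d -> \forall n \near \oo, eps n <= d.
  move=> d0; near=> n; apply: ltW; rewrite /eps.
  by near: n; exact: near_infty_natSinv_lt (PosNum d0).
have : cvgn w.
  apply: cauchy_cvg; apply: cauchy_exP => e e0.
  (* 16 K + 1 makes 4 K omega(d) <= e / 4, and stays positive if K = 0. *)
  have [d d0 wd] := modulus_small homega (e / (16 * K + 1))
    ltac:(by rewrite divr_gt0// ltr_wpDl// mulr_ge0).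
  have [N _ HN] := small (d * (e / 4)) ltac:(by rewrite !mulr_gt0).
  exists (w N); rewrite -ball_normE; exists N => // n /= Nn.
  have em : eps n <= d * (e / 4) := HN n Nn.
  have eN : eps N <= d * (e / 4) := HN N (leqnn N).
  rewrite /ball_/= -(ltr_pM2l d0); apply: le_lt_trans (dist N n d d0) _.
  move: wd; rewrite ler_pdivlMr ?ltr_wpDl ?mulr_ge0// => wd.
  have w0 := modulus_ge0 homega (ltW d0).
  have : d * (omega d * (16 * K + 1)) <= d * e by rewrite ler_pM2l.
  have : 0 <= d * omega d by rewrite mulr_ge0// ltW.
  have : 0 < d * e by rewrite mulr_gt0.
  lra.
move=> /cvg_ex[v wv]; exists v => k.
apply/ler_addgt0Pr => e e0.
near \oo => n.
have H1 : eps n <= e / 2 by near: n; apply: small; rewrite divr_gt0.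
have H2 : `|v - w n| <= e / 2 / (`|k| + 1).
  near: n; apply: cvgr_dist_le wv _ _; by rewrite !divr_gt0// ltr_wpDl.
have := dot_le_norm (v - w n) k; rewrite dotDl dotNl.
have := Hw n k.
move: H2; rewrite ler_pdivlMr ?ltr_wpDl// mulrDr mulr1.
have := normr_ge0 (v - w n); lra.
Unshelve. all: by end_near.
Qed.

(** The upper estimate uses averaging of k against - m k with weights
    m / (1 + m) and 1 / (1 + m): since F(y - m k) is bounded below by the
    tangent, it leaves the error 2 K phi(m |k|) / m, which tends to 0 with m. *)
Lemma envelope_taylor (y : X) : exists v : X, forall k,
  `|F (y + k) - F y - dot v k| <= K * phi `|k|.
Proof.
have [v Hv] := envelope_tangent y; exists v => k.
have [->|k0] := eqVneq k 0.
  by rewrite addr0 dot0r subrr subr0 !normr0 phi_0 mulr0.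
have nk0 : 0 < `|k| by rewrite normr_gt0.
rewrite ler_norml; apply/andP; split; first by have := Hv k; lra.
apply/ler_addgt0Pr => e e0.
have [d d0 wd] := modulus_small homega (e / (2 * K * `|k| + 1))
    ltac:(by rewrite divr_gt0// ltr_wpDl// !mulr_ge0).
(* With this m, the second increment - m k has length d. *)
pose m := d / `|k|.
have m0 : 0 < m by rewrite divr_gt0.
have m1 : 0 < 1 + m by rewrite addr_gt0.
have nmk : `|- (m *: k)| = d.
  by rewrite normrN normrZ gtr0_norm// divfK ?gt_eqF.
have := envelope_avg (m / (1 + m)) (1 + m)^-1 k (- (m *: k)) y.
rewrite scalerN scalerA (mulrC _ m) subrr nmk.
have wm0 : 0 <= m / (1 + m) by rewrite divr_ge0 ?(ltW m0) ?(ltW m1).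
have w10 : 0 <= (1 + m)^-1 by rewrite invr_ge0 (ltW m1).
have w1 : m / (1 + m) + (1 + m)^-1 = 1 by field; rewrite gt_eqF.
move=> /(_ wm0 w10 w1 erefl).
rewrite -(ler_pM2l m1).
have -> : (1 + m) * (m / (1 + m) * F (y + k) + (1 + m)^-1 * F (y - m *: k)) =
  m * F (y + k) + F (y - m *: k) by field; rewrite gt_eqF.
have -> : (1 + m) * (F y + K * (m / (1 + m) * phi `|k| + (1 + m)^-1 * phi d)) =
  (1 + m) * F y + K * (m * phi `|k| + phi d) by field; rewrite gt_eqF.
have := Hv (- (m *: k)); rewrite nmk dotNr dotZr => h1 h2.
have h3 := phi_le_modulus homega _ (ltW d0).
move: wd; rewrite ler_pdivlMr; last by rewrite ltr_wpDl// !mulr_ge0.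
move=> wd; have w0 := modulus_ge0 homega (ltW d0).
rewrite -(ler_pM2l m0).
have h4 : K * phi d <= K * (m * `|k| * omega d).
  by rewrite ler_wpM2l// /m divfK// gt_eqF.
have h5 : m * (omega d * (2 * K * `|k| + 1)) <= m * e by rewrite ler_pM2l.
have h6 : 0 <= m * omega d by rewrite mulr_ge0// ltW.
nra.
Qed.
End Envelope.

(** * The family of minorants and the upper envelope *)

(** The vector is the gradient at y: each term of the convex combination obeys
    phi_norm_tangent, and the weights sum to 1, so the constant stays 2 M. *)
Lemma familyF_tangent (M : R) (h : X -> R) : 0 <= M -> familyF dot omega M h ->
  forall y, exists w : X, forall k, h y + dot w k - 2 * M * phi `|k| <= h (y + k).
Proof.
move=> M0 [n [a [xi [p [l [l0 l1 ->]]]]]] y.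
have /choice[v Hv] : forall i, exists v : X, forall k,
    phi `|y - p i + k| <= phi `|y - p i| + dot v k + 2 * phi `|k|.
  by move=> i; exact: phi_norm_tangent.
exists (xi - \sum_i (l i * M) *: v i) => k.
rewrite dotDr dotDl dotNl dot_suml.
suff : \sum_i l i * M * phi `|y + k - p i| <=
    \sum_i l i * M * phi `|y - p i| + \sum_i dot ((l i * M) *: v i) k
    + 2 * M * phi `|k|.
  lra.
have -> : 2 * M * phi `|k| = \sum_i l i * (2 * M * phi `|k|).
  by rewrite -mulr_suml l1 mul1r.
rewrite -!big_split/=; apply: ler_sum => i _.
rewrite dotZl (addrAC y); have := Hv i k => /(ler_wpM2l (mulr_ge0 (l0 i) M0)).
lra.
Qed.

(** A sum over 'I_(n1 + n2) merges the two lists of centres, each shifted by the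
    corresponding translation and weighted by a or b. *)
Lemma familyF_avg (M : R) (h1 h2 : X -> R) (a b c : R) (k1 k2 : X) :
  familyF dot omega M h1 -> familyF dot omega M h2 ->
  0 <= a -> 0 <= b -> a + b = 1 ->
  familyF dot omega M (fun z => a * h1 (z + k1) + b * h2 (z + k2) + c).
Proof.
move=> [n1 [a1 [xi1 [p1 [l1 [l10 l11 ->]]]]]].
move=> [n2 [a2 [xi2 [p2 [l2 [l20 l21 ->]]]]]].
move=> a0 b0 ab.
exists (n1 + n2)%N, (a * (a1 + dot xi1 k1) + b * (a2 + dot xi2 k2) + c),
  (a *: xi1 + b *: xi2),
  (fun i : 'I_(n1 + n2) => match fintype.split i with inl j => p1 j - k1 | inr j => p2 j - k2 end),
  (fun i : 'I_(n1 + n2) => match fintype.split i with inl j => a * l1 j | inr j => b * l2 j end).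
split.
- by move=> i; case: fintype.split => j; rewrite mulr_ge0.
- rewrite big_split_ord/=.
  under eq_bigr do rewrite (unsplitK (inl _)).
  under [X in _ + X]eq_bigr do rewrite (unsplitK (inr _)).
  by rewrite -!mulr_sumr l11 l21 !mulr1.
- apply/funext => z; rewrite big_split_ord/=.
  rewrite [X in _ = _ - (X + _)](eq_bigr (fun i => a * (l1 i * M * phi `|z + k1 - p1 i|))); last first.
    by move=> i _; rewrite (unsplitK (inl _)) opprB addrA addrAC !mulrA.
  rewrite [X in _ = _ - (_ + X)](eq_bigr (fun i => b * (l2 i * M * phi `|z + k2 - p2 i|)));
    last first.
    by move=> i _; rewrite (unsplitK (inr _)) opprB addrA addrAC !mulrA.
  by rewrite -!mulr_sumr !dotDr dotDl !dotZl; ring.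
Qed.

Lemma familyF_cone (M b : R) (v z : X) :
  familyF dot omega M (fun x => b + dot v (x - z) - M * phi `|x - z|).
Proof.
exists 1%N, (b - dot v z), v, (fun=> z), (fun=> 1); split => //.
- by rewrite big_ord1.
- by apply/funext => x; rewrite big_ord1 mul1r dotDr dotNr; ring.
Qed.

Lemma cone_tangent (M b : R) (v y z : X) : 0 <= M -> exists w : X, forall k,
  b + dot v (z + k - y) + M * phi `|z + k - y| <=
  b + dot v (z - y) + M * phi `|z - y| + dot w k + 2 * M * phi `|k|.
Proof.
move=> M0; have [w Hw] := phi_norm_tangent (z - y).
exists (v + M *: w) => k; rewrite (addrAC z) dotDr dotDl dotZl.
by have := ler_wpM2l M0 (Hw k); lra.
Qed.

Lemma below_upper_env (M : R) (E : set X) (f : X -> R) (G : X -> X) (c : R) (z : X) :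
  (c%:E <= upper_env dot omega M E f G z)%E <->
  forall y, E y -> c <= f y + dot (G y) (z - y) + M * phi `|z - y|.
Proof.
split=> [H y Ey|H].
- by rewrite -lee_fin (le_trans H)//; apply: ereal_inf_lbound; exists y.
- by apply: le_ereal_inf_tmp => _ [y Ey <-]; rewrite lee_fin; exact: H.
Qed.

End InnerProduct.

(** * The extension theorem *)

Theorem theorem3p7 (R : realType) (X : completeNormedModType R)
    (dot : {dot X for idfun}) (hdot : norm_from_dot dot)
    (omega : R -> R) (homega : modulus_of_continuity omega)
    (E : set X) (hE : E !=set0) (f : X -> R) (G : X -> X)
    (hA : (jetA dot omega E f G < +oo)%E) :
  let M := fine (jetA dot omega E f G) in
  let g := upper_env dot omega M E f G in
  let Fbar := lower_env dot omega M g in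
  (forall x : X, Fbar x \is a fin_num) /\
  let F := fun x : X => fine (Fbar x) in
  [/\ C1omega dot omega F,
      forall x : X, E x -> F x = f x /\ grad dot F x = G x &
      (jetA dot omega setT F (grad dot F) <= 2%:E * jetA dot omega E f G)%E].
Proof.
move=> M g Fbar.
pose phi := modulus_primitive omega.
have A0 : (0 <= jetA dot omega E f G)%E by rewrite le_max lexx.
have ME : jetA dot omega E f G = M%:E by rewrite fineK// ge0_fin_numE.
have M0 : 0 <= M by rewrite fine_ge0.
pose S := [set h | familyF dot omega M h /\ forall z, ((h z)%:E <= g z)%E].
have S_cone z : E z -> S (fun x => f z + dot (G z) (x - z) - M * phi `|x - z|).
  move=> Ez; split; first exact: familyF_cone.
  move=> x; apply/below_upper_env => y Ey.
  have := jetA_whitney homega E f G x z y hA Ez Ey.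
  by rewrite -/M ler_norml => /andP[_]; rewrite /phi; lra.
have S_upper h y x : S h -> E y -> h x <= f y + dot (G y) (x - y) + M * phi `|x - y|.
  by move=> [_ hg] Ey; exact: (below_upper_env _ _ _ _ _ _).1 (hg x) y Ey.
have Ffin x : Fbar x \is a fin_num.
  have [y Ey] := hE; rewrite fin_numElt; apply/andP; split.
  - apply: (@lt_le_trans _ _ (f y + dot (G y) (x - y) - M * phi `|x - y|)%:E).
      exact: ltNyr.
    by apply: ereal_sup_ubound; eexists; first exact: S_cone Ey.
  - apply: (@le_lt_trans _ _ (f y + dot (G y) (x - y) + M * phi `|x - y|)%:E).
      by apply: ge_ereal_sup => _ [h Sh <-]; rewrite lee_fin; exact: S_upper.
    exact: ltry.
split=> // F.
have F_ub h x : S h -> h x <= F x.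
  by move=> Sh; rewrite -lee_fin fineK//; apply: ereal_sup_ubound; exists h.
have F_lub x e : 0 < e -> exists2 h, S h & F x - e < h x.
  move=> e0; have [_ [h Sh <-]] := ub_ereal_sup_adherent e0 (Ffin x).
  by move=> h_lt; exists h => //; rewrite -lte_fin EFinB fineK.
have S_tangent h : S h -> forall y, exists w : X, forall k,
    h y + dot w k - 2 * M * phi `|k| <= h (y + k).
  by move=> [Fh _]; exact: (familyF_tangent hdot homega).
have S_avg h1 h2 a b k1 k2 : S h1 -> S h2 ->
    0 <= a -> 0 <= b -> a + b = 1 -> a *: k1 + b *: k2 = 0 ->
    exists2 h, S h & forall x, a * h1 (x + k1) + b * h2 (x + k2)
      - 2 * M * (a * phi `|k1| + b * phi `|k2|) <= h x.
  move=> Sh1 Sh2 a0 b0 ab k12.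
  eexists; last by move=> x; exact: lexx.
  split; first by apply: familyF_avg => //; [case: Sh1|case: Sh2].
  move=> z; apply/below_upper_env => y Ey.
  (* The affine parts cancel in the average because a k1 + b k2 = 0. *)
  have [w Hw] := cone_tangent hdot homega M (f y) (G y) y z M0.
  have := ler_wpM2l a0 (le_trans (S_upper _ y (z + k1) Sh1 Ey) (Hw k1)).
  have := ler_wpM2l b0 (le_trans (S_upper _ y (z + k2) Sh2 Ey) (Hw k2)).
  have : a * dot w k1 + b * dot w k2 = 0 by rewrite -!dotZr -dotDr k12 dot0r.
  have -> : a = 1 - b by lra.
  rewrite -/phi; lra.
have K0 : 0 <= 2 * M by rewrite mulr_ge0.
have F_taylor y := envelope_taylor hdot homega K0 S_tangent S_avg F_ub F_lub y.
have F_diff y : differentiable F y.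
  by have [v /(taylor_gradient hdot homega _ _ _ _ K0)[]] := F_taylor y.
have F_grad y k : `|F (y + k) - F y - dot (grad dot F y) k| <= 2 * M * phi `|k|.
  have [v Hv] := F_taylor y.
  by have [_ ->] := taylor_gradient hdot homega _ _ _ _ K0 Hv.
have F_between y x : E y -> f y + dot (G y) (x - y) - M * phi `|x - y| <= F x
    <= f y + dot (G y) (x - y) + M * phi `|x - y|.
  move=> Ey; rewrite (F_ub _ _ (S_cone y Ey)) /=; apply/ler_addgt0Pr => e e0.
  have [h Sh] := F_lub x e e0; have := S_upper h y x Sh Ey; lra.
split.
- split => //; exists (10 * M + 1); first by rewrite ltr_wpDl// mulr_ge0.
  move=> x y; apply: le_trans (grad_modulus hdot homega _ _ _ K0 F_grad x y) _.
  by have := modulus_ge0 homega (normr_ge0 (x - y)); rewrite /M; lra.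
- move=> y Ey.
  have Ff : F y = f y.
    have := F_between y y Ey.
    by rewrite subrr dot0r normr0 /phi phi_0 mulr0 !addr0 subr0 -eq_le => /eqP.
  split => //.
  have [//|//] := taylor_gradient hdot homega F y (G y) M M0.
  move=> k; have := F_between y (y + k) Ey; rewrite (addrAC y k) subrr add0r Ff.
  by rewrite -/phi ler_norml => /andP[? ?]; apply/andP; split; lra.
- by rewrite ME -EFinM; exact: jetA_le.
Qed.
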